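(* Let $G$ be an $r$-regular graph on $n$ vertices, $0\le r\le n-1$, let $m\ge1$, and let $1/2<\alpha<1$. Then $G$ is determined by its $A_\alpha$-spectrum if and only if $G\vee K_m$ is determined by its $A_\alpha$-spectrum.
   Context: All graphs are finite, simple and undirected. For a graph $G$, $A(G)$ is its adjacency matrix, $D(G)$ its diagonal degree matrix, and $A_\alpha(G)=\alpha D(G)+(1-\alpha)A(G)$. A graph is determined by its $A_\alpha$-spectrum if every graph whose $A_\alpha$ matrix has the same multiset of eigenvalues is isomorphic to it. $K_m$ is the complete graph on $m$ vertices and $G\vee H$ is the join (disjoint union plus all edges between the two vertex sets). *)

(* Defs.v *)
From HB Require Import structures.
From mathcomp Require Import all_boot all_order all_algebra.
Set Implicit Arguments. Unset Strict Implicit. Unset Printing Implicit Defensive.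
Import Order.TTheory GRing.Theory Num.Theory.
Local Open Scope ring_scope.

Definition simple_graph (n : nat) (e : rel 'I_n) : Prop :=
  (forall i j, e i j = e j i) /\ (forall i, ~~ e i i).

Definition deg (n : nat) (e : rel 'I_n) (i : 'I_n) : nat := #|[set j | e i j]|.

Definition regular (n r : nat) (e : rel 'I_n) : Prop := forall i, deg e i = r.

Definition adjmx (R : numDomainType) (n : nat) (e : rel 'I_n) : 'M[R]_n :=
  \matrix_(i, j) (e i j)%:R.

Definition degmx (R : numDomainType) (n : nat) (e : rel 'I_n) : 'M[R]_n :=
  \matrix_(i, j) ((i == j)%:R * (deg e i)%:R).

Definition Aalpha (R : numDomainType) (alpha : R) (n : nat) (e : rel 'I_n) : 'M[R]_n :=
  alpha *: degmx R e + (1 - alpha) *: adjmx R e.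

(* Multiset of eigenvalues: lambda |-> algebraic multiplicity of lambda
   (root multiplicity in the characteristic polynomial). *)
Definition spectrum (R : rcfType) (n : nat) (A : 'M[R]_n) : R -> nat :=
  fun lambda => mup lambda (char_poly A).

Definition Aalpha_cospectral (R : rcfType) (alpha : R) (n p : nat)
  (e : rel 'I_n) (h : rel 'I_p) : Prop :=
  spectrum (Aalpha alpha e) =1 spectrum (Aalpha alpha h).

Definition graph_iso (n p : nat) (e : rel 'I_n) (h : rel 'I_p) : Prop :=
  exists f : 'I_n -> 'I_p, bijective f /\ forall i j, h (f i) (f j) = e i j.

Definition determined_by_Aalpha_spectrum (R : rcfType) (alpha : R) (n : nat)
  (e : rel 'I_n) : Prop :=
  forall (p : nat) (h : rel 'I_p), simple_graph h ->
    Aalpha_cospectral alpha e h -> graph_iso e h.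

Definition complete (m : nat) : rel 'I_m := fun i j => i != j.
Arguments complete : clear implicits.

Definition gjoin (n m : nat) (e : rel 'I_n) (f : rel 'I_m) : rel 'I_(n + m) :=
  fun i j =>
    match split i, split j with
    | inl a, inl b => e a b
    | inr a, inr b => f a b
    | _, _ => true
    end.

(* Main.v *)
Require Import Defs.
From HB Require Import structures.
From mathcomp Require Import all_boot all_order all_algebra fingroup perm.
From mathcomp Require Import ring lra zify complex.
Import Order.TTheory GRing.Theory Num.Theory.
Local Open Scope ring_scope.
Set Implicit Arguments. Unset Strict Implicit. Unset Printing Implicit Defensive.

(** The traces of A_alpha and of its square fix the sums of the degrees and of
    their squares, hence regularity, and for r-regular G the characteristic
    polynomial of the join of G and K_m is that of G up to a shift and factors
    depending only on n, m, r.  The theorem thus reduces to showing that a graph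
    H with the spectrum of the join has m dominating vertices.

    Let N = n + m, kappa = alpha N - 1 and B = A_alpha(H).  Then
    kappa I + (1 - alpha) J - B is A_alpha of the complement of H; as
    alpha > 1/2 it is positive semidefinite and its kernel is spanned by the
    dominating vertices of H.  Since B has an eigenvalue L > kappa, every
    kappa-eigenvector of B is orthogonal to 1 and lives on the dominating
    vertices; as kappa has multiplicity at least m - 1, there are at least m of
    them as soon as there is one.

    To find one, write 1 in an eigenbasis of B.  The squared coordinates are a
    measure on the spectrum with moments N, sum d_i, sum d_i^2 (because
    B 1 = d), the same as for the join, where it is carried by the two
    eigenvalues a < kappa < L of the quotient matrix.  Comparing 1/(x - kappa)
    with the quadratic touching it at a and meeting it at L bounds the integral
    of 1/(x - kappa) by 1/(1 - alpha), which is incompatible with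
    kappa I + (1 - alpha) J - B being positive definite. *)

(** * The real spectral theorem *)

Lemma dot_rVE (R : pzRingType) (n : nat) (u v : 'rV[R]_n) :
  (u *m v^T) 0 0 = \sum_j u 0 j * v 0 j.
Proof. by rewrite mxE; apply: eq_bigr => j _; rewrite mxE. Qed.

Lemma sqr_rV_eq0 (R : realDomainType) (n : nat) (u : 'rV[R]_n) :
  (u *m u^T) 0 0 = 0 -> u = 0.
Proof.
rewrite dot_rVE => u0; apply/rowP => j; rewrite mxE; apply/eqP.
rewrite -sqrf_eq0 expr2; apply/eqP.
by have /psumr_eq0P -> := u0 => // k _; rewrite -expr2 sqr_ge0.
Qed.

Lemma sqr_rV_ge0 (R : realDomainType) (n : nat) (u : 'rV[R]_n) :
  0 <= (u *m u^T) 0 0.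
Proof. by rewrite dot_rVE sumr_ge0 => // j _; rewrite -expr2 sqr_ge0. Qed.

(** Over [R[i]] an eigenvector [v] exists. With [p] and [q] its real and imaginary parts, symmetry
    of [A] gives Im a (|p|^2 + |q|^2) = 0, so the eigenvalue is already real. *)
Lemma symmetric_eigenvalue_exists (R : rcfType) (n : nat) (A : 'M[R]_n) :
  A^T = A -> (0 < n)%N -> exists x, eigenvalue A x.
Proof.
move=> symA n_gt0.
pose f : {rmorphism R -> R[i]} := real_complex R.
have [a /eigenvalueP [v vA v_neq0]] := @eigenvalue_closed R[i] n (map_mx f A) n_gt0.
pose p : 'rV[R]_n := map_mx (@complex.Re R) v.
pose q : 'rV[R]_n := map_mx (@complex.Im R) v.
have Ev j : \sum_k v 0 k * f (A k j) = a * v 0 j.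
  have /matrixP/(_ 0 j) := vA; rewrite !mxE => <-.
  by apply: eq_bigr => k _; rewrite !mxE.
have Ep : p *m A = complex.Re a *: p - complex.Im a *: q.
  apply/rowP => j; rewrite !mxE.
  have := congr1 (@complex.Re R) (Ev j); rewrite raddf_sum /=.
  case: a {vA Ev} => x y; case E: (v 0 j) => [s t] /= <-.
  by apply: eq_bigr => k _; rewrite !mxE; case: (v 0 k) => s' t' /=; rewrite mulr0 subr0.
have Eq : q *m A = complex.Im a *: p + complex.Re a *: q.
  apply/rowP => j; rewrite !mxE.
  have := congr1 (@complex.Im R) (Ev j); rewrite raddf_sum /=.
  case: a {vA Ev Ep} => x y; case E: (v 0 j) => [s t] /=; rewrite addrC => <-.
  by apply: eq_bigr => k _; rewrite !mxE; case: (v 0 k) => s' t' /=; rewrite mulr0 add0r mulrC.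
(* The two 1 x 1 matrices are transposes of each other. *)
have eq_pq : (p *m A *m q^T) 0 0 = (q *m A *m p^T) 0 0.
  by rewrite -[in RHS](mxE trmx_key (fun i j => (q *m A *m p^T) j i)) -/(trmx _) !trmx_mul trmxK symA mulmxA.
have y0 : complex.Im a = 0.
  have pq0 : complex.Im a * ((p *m p^T) 0 0 + (q *m q^T) 0 0) = 0.
    have qp : (q *m p^T) 0 0 = (p *m q^T) 0 0.
      by rewrite !dot_rVE; apply: eq_bigr => j _; rewrite mulrC.
    have E1 : (p *m A *m q^T) 0 0 =
        complex.Re a * (p *m q^T) 0 0 - complex.Im a * (q *m q^T) 0 0.
      by rewrite Ep mulmxBl -!scalemxAl !mxE.
    have E2 : (q *m A *m p^T) 0 0 =
        complex.Im a * (p *m p^T) 0 0 + complex.Re a * (q *m p^T) 0 0.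
      by rewrite Eq mulmxDl -!scalemxAl !mxE.
    move: eq_pq; rewrite E1 E2 qp; lra.
  have /eqP := pq0; rewrite mulf_eq0 => /orP [/eqP // |].
  rewrite paddr_eq0 ?sqr_rV_ge0 // => /andP [/eqP /sqr_rV_eq0 p0 /eqP /sqr_rV_eq0 q0].
  case/negP: v_neq0; apply/eqP/rowP => j; rewrite mxE.
  move/rowP: p0 => /(_ j); move/rowP: q0 => /(_ j); rewrite !mxE.
  by case: (v 0 j) => s t /= -> ->.
exists (complex.Re a); rewrite eigenvalue_root_char.
have : eigenvalue (map_mx f A) a by apply/eigenvalueP; exists v.
rewrite eigenvalue_root_char -map_char_poly.
have -> : a = f (complex.Re a) by move: y0; case: a {vA Ev Ep Eq} => x y /= ->.
by rewrite fmorph_root.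
Qed.

(* Q is the Householder reflection along u - e_1. *)
Lemma reflection_to_first_axis (R : realFieldType) (n : nat) (u : 'rV[R]_n.+1) :
  (u *m u^T) 0 0 = 1 ->
  exists2 Q : 'M[R]_n.+1, Q^T = Q /\ Q *m Q = 1%:M & u *m Q = delta_mx 0 0.
Proof.
move=> u1; pose e1 : 'rV[R]_n.+1 := delta_mx 0 0.
have [ue|une] := eqVneq u e1.
  by exists 1%:M; rewrite ?trmx1 mulmx1.
pose v : 'rV[R]_n.+1 := u - e1; pose t : R := (v *m v^T) 0 0.
have t_neq0 : t != 0.
  by apply: contra une => /eqP /sqr_rV_eq0 /eqP; rewrite subr_eq0.
have vv : v *m v^T = t%:M by rewrite [LHS]mx11_scalar.
have e11 : (e1 *m e1^T) 0 0 = 1 by rewrite trmx_delta mul_delta_mx mxE !eqxx.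
have ue1 : (u *m e1^T) 0 0 = u 0 0 by rewrite trmx_delta -colE mxE.
have e1u : (e1 *m u^T) 0 0 = u 0 0 by rewrite -rowE mxE mxE.
have tE : t = 2 - 2 * u 0 0.
  have subE (X Y : 'M[R]_1) : (X - Y) 0 0 = X 0 0 - Y 0 0 by rewrite !mxE.
  by rewrite /t /v linearB /= mulmxBl !mulmxBr !subE u1 e11 ue1 e1u; ring.
exists (1%:M - (2 / t) *: (v^T *m v)); first split.
- by rewrite linearB /= trmx1 linearZ /= trmx_mul trmxK.
- have EE : v^T *m v *m (v^T *m v) = t *: (v^T *m v).
    by rewrite mulmxA -[v^T *m v *m _]mulmxA vv mul_mx_scalar -scalemxAl.
  rewrite mulmxBl mul1mx [_ *m (1%:M - _)]mulmxBr mulmx1 -scalemxAl -scalemxAr EE !scalerA.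
  rewrite -scalerBl -addrA -opprD -scalerDl.
  have -> : 2 / t + (2 / t - 2 / t * (2 / t) * t) = 0 by field.
  by rewrite scale0r subr0.
- rewrite mulmxBr mulmx1 -scalemxAr mulmxA.
  have -> : u *m v^T = (t / 2)%:M.
    rewrite [LHS]mx11_scalar; congr (_ %:M).
    by rewrite /v linearB /= mulmxBr mxE [X in _ + X]mxE u1 ue1 tE; field.
  rewrite mul_scalar_mx scalerA.
  have -> : 2 / t * (t / 2) = 1 by field.
  by rewrite scale1r /v opprB addrCA subrr addr0.
Qed.

(** By induction on the size: a reflection taking a unit eigenvector to the first axis conjugates
    [A] into block diagonal form, and the induction hypothesis handles the lower block. *)
Theorem symmetric_spectral (R : rcfType) (n : nat) (A : 'M[R]_n) :
  A^T = A ->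
  exists (U : 'M[R]_n) (d : 'rV[R]_n),
    U *m U^T = 1%:M /\ A = U^T *m diag_mx d *m U.
Proof.
elim: n A => [|n IHn] A symA.
  by exists 1%:M, 0; split; apply/matrixP => - [].
have [x /eigenvalueP [v vA v_neq0]] := @symmetric_eigenvalue_exists R _ _ symA isT.
pose s := (v *m v^T) 0 0.
have s_gt0 : 0 < s.
  by rewrite lt_def sqr_rV_ge0 andbT; apply: contra v_neq0 => /eqP/sqr_rV_eq0 ->.
pose u := (Num.sqrt s)^-1 *: v.
have u1 : (u *m u^T) 0 0 = 1.
  rewrite /u linearZ /= -scalemxAl -scalemxAr scalerA mxE -/s -invfM -expr2.
  by rewrite sqr_sqrtr ?ltW // mulVf // gt_eqF.
have uA : u *m A = x *: u by rewrite /u -scalemxAl vA !scalerA mulrC.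
have [Q [symQ QQ] uQ] := reflection_to_first_axis u1.
have eQ : delta_mx 0 0 *m Q = u by rewrite -uQ -mulmxA QQ mulmx1.
have [B defB] : exists B : 'M[R]_(1 + n), B = Q *m A *m Q by exists (Q *m A *m Q).
have symB : B^T = B by rewrite defB !trmx_mul symQ symA mulmxA.
have rowB : row 0 B = x *: delta_mx 0 0.
  by rewrite rowE defB !mulmxA eQ uA -scalemxAl uQ.
have B0 j : B 0 j = x * (j == 0)%:R.
  by have /rowP/(_ j) := rowB; rewrite !mxE eqxx.
have l0 : lshift n 0 = 0 :> 'I_(1 + n) by apply: val_inj.
have BE : B = block_mx x%:M 0 0 (drsubmx B).
  rewrite -[LHS]submxK; congr block_mx.
  - by rewrite [LHS]mx11_scalar !mxE l0 B0 eqxx mulr1.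
  - by apply/matrixP => i j; rewrite ord1 !mxE l0 B0 mulr0.
  - by apply/matrixP => i j; rewrite ord1 -symB !mxE l0 B0 mulr0.
have symB' : (drsubmx B)^T = drsubmx B by rewrite trmx_drsub symB.
have [U [d [UU BU]]] := IHn _ symB'.
pose V : 'M[R]_(1 + n) := block_mx 1%:M 0 0 U.
have VV : V *m V^T = 1%:M.
  rewrite /V tr_block_mx !trmx0 trmx1 mulmx_block !mulmx0 !mul0mx !mulmx1 !addr0 add0r UU.
  by rewrite -scalar_mx_block.
have BV : B = V^T *m diag_mx (row_mx x%:M d) *m V.
  rewrite {1}BE BU /V tr_block_mx !trmx0 trmx1 diag_mx_row !mulmx_block.
  rewrite ?(mulmx0, mul0mx, mulmx1, mul1mx, addr0, add0r).
  by congr block_mx; rewrite [RHS]mx11_scalar !mxE !eqxx.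
exists (V *m Q), (row_mx x%:M d); split.
  by rewrite trmx_mul symQ mulmxA -[_ *m Q *m Q]mulmxA QQ mulmx1.
have -> : A = Q *m B *m Q by rewrite defB !mulmxA QQ mul1mx -!mulmxA QQ mulmx1.
by rewrite BV trmx_mul symQ !mulmxA.
Qed.

(** * Cospectral graphs *)

Lemma char_poly_conj (R : comNzRingType) (n : nat) (U V A : 'M[R]_n) :
  U *m V = 1%:M -> char_poly (V *m A *m U) = char_poly A.
Proof.
move=> UV.
have UVp : map_mx polyC U *m map_mx polyC V = 1%:M by rewrite -map_mxM UV map_mx1.
have -> : char_poly (V *m A *m U) =
    \det (map_mx polyC V *m char_poly_mx A *m map_mx polyC U).
  rewrite /char_poly /char_poly_mx mulmxBr mulmxBl !map_mxM; congr (\det (_ - _)).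
  by rewrite mul_mx_scalar -scalemxAl (mulmx1C UVp) scalemx1.
by rewrite !det_mulmx mulrAC [X in X * _]mulrC -det_mulmx UVp det1 mul1r.
Qed.

Lemma char_poly_diag (R : comNzRingType) (n : nat) (d : 'rV[R]_n) :
  char_poly (diag_mx d) = \prod_(x <- codom (d 0)) ('X - x%:P).
Proof.
rewrite (char_poly_trig (diag_mx_is_trig d)) codomE big_map big_enum /=.
by apply: eq_bigr => i _; rewrite mxE eqxx.
Qed.

Lemma degE (R : pzSemiRingType) (n : nat) (e : rel 'I_n) i : (deg e i)%:R = \sum_j (e i j)%:R :> R.
Proof.
rewrite /deg -sum1_card natr_sum big_mkcond /=.
by apply: eq_bigr => j _; rewrite inE; case: (e i j).
Qed.

Section Cospectral.
Variable R : rcfType.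

(** The eigenvalues come as a sequence, so that matrices of different sizes can be compared. *)
Lemma symmetric_char_poly_split (n : nat) (A : 'M[R]_n) : A^T = A ->
  exists s : seq R, [/\ char_poly A = \prod_(x <- s) ('X - x%:P),
    \tr A = \sum_(x <- s) x & \tr (A *m A) = \sum_(x <- s) x ^+ 2].
Proof.
move=> /symmetric_spectral [U [d [UU AE]]].
have trU (X : 'M[R]_n) : \tr (U^T *m X *m U) = \tr X.
  by rewrite mxtrace_mulC mulmxA UU mul1mx.
exists (codom (d 0)); split.
- by rewrite AE char_poly_conj // char_poly_diag.
- by rewrite AE trU mxtrace_diag codomE big_map big_enum.
have -> : A *m A = U^T *m (diag_mx d *m diag_mx d) *m U.
  by rewrite AE -!mulmxA [U *m (U^T *m _)]mulmxA UU mul1mx.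
rewrite trU mulmx_diag mxtrace_diag codomE big_map big_enum.
by apply: eq_bigr => i _; rewrite mxE expr2.
Qed.

(** Multiplicities are counted in [R] only; they suffice because a symmetric matrix has all its
    eigenvalues in [R]. *)
Lemma spectrum_char_poly (n p : nat) (A : 'M[R]_n) (B : 'M[R]_p) :
  A^T = A -> B^T = B -> spectrum A =1 spectrum B -> char_poly A = char_poly B.
Proof.
move=> /symmetric_char_poly_split [s [As _ _]] /symmetric_char_poly_split [t [Bt _ _]] AB.
rewrite As Bt; apply: perm_big; apply/allP => x _ /=.
by have := AB x; rewrite /spectrum As Bt !mu_prod_XsubC => ->.
Qed.

Lemma char_poly_trace2 (n p : nat) (A : 'M[R]_n) (B : 'M[R]_p) :
  A^T = A -> B^T = B -> char_poly A = char_poly B ->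
  \tr A = \tr B /\ \tr (A *m A) = \tr (B *m B).
Proof.
move=> /symmetric_char_poly_split [s [As -> ->]] /symmetric_char_poly_split [t [Bt -> ->]].
by rewrite As Bt => /prod_XsubC_eq st; split; apply: perm_big.
Qed.

Variable alpha : R.

Lemma AalphaE (n : nat) (e : rel 'I_n) i j :
  Aalpha alpha e i j = alpha * ((i == j)%:R * (deg e i)%:R) + (1 - alpha) * (e i j)%:R.
Proof. by rewrite !mxE. Qed.

Lemma Aalpha_sym (n : nat) (e : rel 'I_n) : simple_graph e ->
  (Aalpha alpha e)^T = Aalpha alpha e.
Proof.
move=> [symE _]; apply/matrixP => i j; rewrite mxE !AalphaE symE eq_sym.
by case: eqP => [->|]; rewrite ?mul0r.
Qed.

Lemma trace_Aalpha (n : nat) (e : rel 'I_n) : simple_graph e ->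
  \tr (Aalpha alpha e) = alpha * \sum_i (deg e i)%:R.
Proof.
move=> [_ irrE]; rewrite /mxtrace mulr_sumr; apply: eq_bigr => i _.
by rewrite AalphaE eqxx (negbTE (irrE i)) mul1r mulr0 addr0.
Qed.

Lemma trace_Aalpha_sqr (n : nat) (e : rel 'I_n) : simple_graph e ->
  \tr (Aalpha alpha e *m Aalpha alpha e) =
    alpha ^+ 2 * \sum_i (deg e i)%:R ^+ 2 + (1 - alpha) ^+ 2 * \sum_i (deg e i)%:R.
Proof.
move=> [symE irrE]; rewrite /mxtrace !mulr_sumr -big_split /=; apply: eq_bigr => i _.
rewrite mxE {2}degE mulr_sumr (bigD1 i) //= [in RHS](bigD1 i) //= addrA; congr (_ + _).
  by rewrite AalphaE eqxx (negbTE (irrE i)); rewrite ?mulr0n ?mulr1n; ring.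
apply: eq_bigr => j ji; rewrite !AalphaE (negbTE ji) eq_sym (negbTE ji) [e j i]symE.
by case: (e i j); rewrite ?mulr0n ?mulr1n; ring.
Qed.

(** The trace yields the degree sum; once that is known, the trace of the square yields the sum of
    squares. Dividing by [alpha] and its square uses [alpha != 0]. *)
Lemma char_poly_degree_sums (n p : nat) (e : rel 'I_n) (h : rel 'I_p) :
  alpha != 0 -> simple_graph e -> simple_graph h ->
  char_poly (Aalpha alpha e) = char_poly (Aalpha alpha h) ->
  \sum_i (deg e i)%:R = \sum_i (deg h i)%:R :> R /\
  \sum_i (deg e i)%:R ^+ 2 = \sum_i (deg h i)%:R ^+ 2 :> R.
Proof.
move=> alpha0 se sh /(char_poly_trace2 (Aalpha_sym se) (Aalpha_sym sh)).
rewrite !trace_Aalpha // !trace_Aalpha_sqr // => -[/(mulfI alpha0) -> /addIr].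
by move/(mulfI (expf_neq0 2 alpha0)) ->.
Qed.

Lemma cospectral_char_poly (n p : nat) (e : rel 'I_n) (h : rel 'I_p) :
  simple_graph e -> simple_graph h -> Aalpha_cospectral alpha e h ->
  n = p /\ char_poly (Aalpha alpha e) = char_poly (Aalpha alpha h).
Proof.
move=> se sh eh; have E := spectrum_char_poly (Aalpha_sym se) (Aalpha_sym sh) eh.
by split=> //; have := congr1 (size \o val) E; rewrite /= !size_char_poly => -[].
Qed.

(** The two sums force the squared deviations of the degrees from [r] to add up to 0. *)
Lemma regular_of_degree_sums (n r : nat) (e : rel 'I_n) :
  \sum_i (deg e i)%:R = n%:R * r%:R :> R ->
  \sum_i (deg e i)%:R ^+ 2 = n%:R * r%:R ^+ 2 :> R -> regular r e.
Proof.
move=> S1 S2.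
have sum0 : \sum_i ((deg e i)%:R - r%:R) ^+ 2 = 0 :> R.
  transitivity (\sum_i ((deg e i)%:R ^+ 2 - (deg e i)%:R * (2 * r%:R) + r%:R ^+ 2) : R).
    by apply: eq_bigr => i _; ring.
  rewrite big_split sumrB -mulr_suml S1 S2 sumr_const card_ord -mulr_natl /=; ring.
move=> i; apply/eqP; rewrite -(eqr_nat R) -subr_eq0 -sqrf_eq0; apply/eqP.
by have /psumr_eq0P -> := sum0 => // j _; rewrite sqr_ge0.
Qed.

Lemma regular_sum (n r k : nat) (e : rel 'I_n) : regular r e ->
  \sum_i (deg e i)%:R ^+ k = n%:R * r%:R ^+ k :> R.
Proof.
move=> er; under eq_bigr => i _ do rewrite er.
by rewrite sumr_const card_ord mulr_natl.
Qed.

Lemma regular_of_char_poly (n r : nat) (e h : rel 'I_n) :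
  alpha != 0 -> simple_graph e -> simple_graph h -> regular r e ->
  char_poly (Aalpha alpha e) = char_poly (Aalpha alpha h) -> regular r h.
Proof.
move=> alpha0 se sh er /(char_poly_degree_sums alpha0 se sh) [S1 S2].
apply: regular_of_degree_sums; first by rewrite -S1 (regular_sum 1 er).
by rewrite -S2 (regular_sum 2 er).
Qed.
End Cospectral.

(** * Joins with complete graphs *)

Lemma char_poly_addC (R : comNzRingType) (n : nat) (A : 'M[R]_n) (c : R) :
  char_poly (A + c%:M) = char_poly A \Po ('X - c%:P).
Proof.
rewrite /char_poly -[RHS](det_map_mx (comp_poly ('X - c%:P))); congr (\det _).
apply/matrixP => i j; rewrite !mxE /= rmorphB /= comp_polyC.
case: (i == j); rewrite ?mulr1n ?mulr0n ?comp_polyX ?comp_poly0 ?addr0 // polyCD; ring.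
Qed.

Lemma char_poly_addC_inj (R : comNzRingType) (n p : nat) (A : 'M[R]_n) (B : 'M[R]_p) (c : R) :
  char_poly (A + c%:M) = char_poly (B + c%:M) -> char_poly A = char_poly B.
Proof.
rewrite !char_poly_addC => /(congr1 (comp_poly ('X + c%:P))).
by rewrite -!comp_polyA comp_polyB comp_polyX comp_polyC addrK !comp_polyXr.
Qed.

(** The bordered matrix [W] is reduced in two ways, by a row operation and by a column operation.
    The factor [c] on the left keeps the formula free of division and valid for m = 0. *)
Lemma det_scalar_sub_const (S : comPzRingType) (m : nat) (c d : S) :
  c * \det (c%:M - const_mx d : 'M_m) = (c - m%:R * d) * c ^+ m.
Proof.
pose W : 'M[S]_(1 + m) := block_mx 1%:M (const_mx d) (const_mx 1) c%:M.
have detW : \det W = \det (c%:M - const_mx d : 'M_m).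
  have : block_mx 1%:M 0 (const_mx (-1)) 1%:M *m W =
      block_mx 1%:M (const_mx d) 0 (c%:M - const_mx d).
    rewrite /W mulmx_block !mul1mx !mul0mx !addr0 !mulmx1; congr block_mx.
      by apply/matrixP => i j; rewrite !mxE addNr.
    apply/matrixP => i j; rewrite !mxE big_ord1 !mxE; ring.
  by move/(congr1 determinant); rewrite det_mulmx det_lblock det_ublock !det1 !mul1r.
have : W *m block_mx c%:M 0 (const_mx (-1)) 1%:M =
    block_mx (c - m%:R * d)%:M (const_mx d) 0 c%:M.
  rewrite /W mulmx_block !mul1mx !mulmx0 !add0r !mulmx1; congr block_mx.
    rewrite [LHS]mx11_scalar !mxE; congr _%:M; congr (_ + _).
    under eq_bigr => k _ do rewrite !mxE mulrN1.
    by rewrite sumr_const card_ord mulNrn mulr_natl.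
  apply/matrixP => i j; rewrite mul_mx_scalar mul_scalar_mx !mxE; ring.
move/(congr1 determinant); rewrite det_mulmx det_lblock det_ublock det1 mulr1.
by rewrite !det_scalar expr1 detW mulrC.
Qed.

(** A Schur complement without inverses: constant row sums turn [P *m const_mx b] into a constant
    block p b, so a block column operation clears the upper right corner at the price of
    [p ^+ m]. *)
Lemma det_bordered (S : comPzRingType) (n m : nat) (P : 'M[S]_n) (p b c : S) :
  (forall i, \sum_k P i k = p) ->
  \det (block_mx P (const_mx (- b)) (const_mx (- b)) (c%:M - const_mx b : 'M_m)) * p ^+ m =
  \det P * \det ((p * c)%:M - const_mx (p * b + b ^+ 2 * n%:R) : 'M_m).
Proof.
move=> rowP.
have : block_mx P (const_mx (- b)) (const_mx (- b)) (c%:M - const_mx b : 'M_m) *m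
    block_mx 1%:M (const_mx b) 0 (p%:M : 'M_m) =
    block_mx P 0 (const_mx (- b)) ((p * c)%:M - const_mx (p * b + b ^+ 2 * n%:R)).
  rewrite mulmx_block !mulmx1 !mulmx0 !addr0 !mul_mx_scalar; congr block_mx.
    apply/matrixP => i j; rewrite !mxE.
    under eq_bigr => k _ do rewrite !mxE.
    rewrite -mulr_suml rowP; ring.
  apply/matrixP => i j; rewrite !mxE.
  under eq_bigr => k _ do rewrite !mxE.
  rewrite sumr_const card_ord -[X in X + _]mulr_natl; case: (i == j); rewrite ?mulr1n ?mulr0n; ring.
by move/(congr1 determinant); rewrite det_mulmx det_ublock det_lblock det1 mul1r det_scalar.
Qed.

Section JoinComplete.
Variables (n m : nat).
Implicit Types e : rel 'I_n.

Lemma gjoin_ll e (f : rel 'I_m) i j : gjoin e f (lshift m i) (lshift m j) = e i j.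
Proof. by rewrite /gjoin !(unsplitK (inl _)). Qed.
Lemma gjoin_lr e (f : rel 'I_m) i j : gjoin e f (lshift m i) (rshift n j) = true.
Proof. by rewrite /gjoin (unsplitK (inl _)) (unsplitK (inr _)). Qed.
Lemma gjoin_rl e (f : rel 'I_m) i j : gjoin e f (rshift n i) (lshift m j) = true.
Proof. by rewrite /gjoin (unsplitK (inl _)) (unsplitK (inr _)). Qed.
Lemma gjoin_rr e (f : rel 'I_m) i j : gjoin e f (rshift n i) (rshift n j) = f i j.
Proof. by rewrite /gjoin !(unsplitK (inr _)). Qed.
Definition gjoinE := (gjoin_ll, gjoin_lr, gjoin_rl, gjoin_rr).

Lemma simple_complete : simple_graph (complete m).
Proof. by split=> [i j|i]; rewrite /complete ?eqxx // eq_sym. Qed.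

Lemma simple_gjoin e (f : rel 'I_m) :
  simple_graph e -> simple_graph f -> simple_graph (gjoin e f).
Proof.
move=> [se ie] [sf jf]; split=> [i j|i].
  by case: (split_ordP i) => ? ->; case: (split_ordP j) => ? ->; rewrite !gjoinE.
by case: (split_ordP i) => ? ->; rewrite !gjoinE.
Qed.

Lemma deg_gjoin_l e (f : rel 'I_m) i : deg (gjoin e f) (lshift m i) = (deg e i + m)%N.
Proof.
apply/eqP; rewrite -(eqr_nat int) natrD !degE big_split_ord /=; apply/eqP; congr (_ + _).
  by apply: eq_bigr => j _; rewrite gjoinE.
by under eq_bigr => j _ do rewrite gjoinE; rewrite sumr_const card_ord.
Qed.

Lemma deg_gjoin_complete_r e i : deg (gjoin e (complete m)) (rshift n i) = (n + m).-1.
Proof.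
apply/eqP; rewrite -(eqr_nat int) degE big_split_ord /=.
under eq_bigr => j _ do rewrite gjoinE.
rewrite sumr_const card_ord (bigD1 i) //= gjoinE /complete eqxx add0r.
under eq_bigr => j ji do rewrite gjoinE eq_sym ji.
rewrite sumr_const -natrD eqr_nat; apply/eqP.
have := cardC1 i; rewrite card_ord => E.
have -> : #|(fun j : 'I_m => j != i)| = m.-1 by rewrite -E; apply: eq_card.
by case: m i {E} => [[]|k] // _; rewrite addnS.
Qed.

Variables (R : rcfType) (alpha : R).

(* A_alpha(G) + A_alpha(complement of G) = kappa I + (1 - alpha) J on n + m vertices. *)
Definition kappa : R := alpha * (n + m)%:R - 1.

Lemma Aalpha_gjoin_complete e : simple_graph e ->
  Aalpha alpha (gjoin e (complete m)) =
  block_mx (Aalpha alpha e + (alpha * m%:R)%:M) (const_mx (1 - alpha))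
    (const_mx (1 - alpha)) (kappa%:M + const_mx (1 - alpha)).
Proof.
move=> [_ irrE]; apply/matrixP => i j; rewrite AalphaE.
case: (split_ordP i) => i' ->; case: (split_ordP j) => j' ->;
  rewrite gjoinE ?block_mxEul ?block_mxEur ?block_mxEdl ?block_mxEdr.
- rewrite deg_gjoin_l (inj_eq (@lshift_inj _ _)) !mxE natrD.
  by case: (i' == j'); rewrite ?mulr1n ?mulr0n; ring.
- by rewrite eq_lrshift mxE mulr0n mulr1n; ring.
- by rewrite eq_rlshift mxE mulr0n mulr1n; ring.
rewrite deg_gjoin_complete_r (inj_eq (@rshift_inj _ _)) !mxE /complete /kappa.
case: eqP => _ /=; rewrite ?mulr1n ?mulr0n; last by ring.
have -> : (n + m)%:R = 1 + (n + m).-1%:R :> R.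
  have : (0 < n + m)%N by rewrite addn_gt0 (leq_ltn_trans _ (ltn_ord i')) ?orbT.
  by case: (n + m)%N => // k _; rewrite mulrS.
ring.
Qed.

Variable r : nat.
Definition deg_join : R := r%:R + alpha * m%:R.

(* Characteristic polynomial of the quotient matrix of the partition
   {V(G), V(K_m)} of the join of an r-regular graph G and K_m. *)
Definition quotient_poly : {poly R} :=
  ('X - deg_join%:P) * ('X - kappa%:P - ((1 - alpha) * m%:R)%:P)
  - ((1 - alpha) ^+ 2 * (n * m)%:R)%:P.

Lemma row_sum_Aalpha (k : nat) (e : rel 'I_k) i : \sum_j Aalpha alpha e i j = (deg e i)%:R.
Proof.
under eq_bigr => j _ do rewrite AalphaE.
rewrite big_split -!mulr_sumr /= -degE (bigD1 i) //= eqxx mul1r big1 ?addr0; first by ring.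
by move=> j; rewrite eq_sym => /negbTE ->; rewrite mul0r.
Qed.

(** Regularity gives the upper left block of the characteristic matrix constant row sums, so
    [det_bordered] applies. The factor on the left is the eigenvalue of the all-ones vector of G,
    which the roots of [quotient_poly] replace in the join. *)
Lemma char_poly_gjoin e : simple_graph e -> regular r e -> (0 < m)%N ->
  ('X - deg_join%:P) * char_poly (Aalpha alpha (gjoin e (complete m))) =
  char_poly (Aalpha alpha e + (alpha * m%:R)%:M) * ('X - kappa%:P) ^+ m.-1 * quotient_poly.
Proof.
move=> se er m_gt0; set p := 'X - deg_join%:P; set x := 'X - kappa%:P.
have -> : char_poly (Aalpha alpha (gjoin e (complete m))) =
    \det (block_mx (char_poly_mx (Aalpha alpha e + (alpha * m%:R)%:M))
      (const_mx (- (1 - alpha)%:P)) (const_mx (- (1 - alpha)%:P))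
      (x%:M - const_mx (1 - alpha)%:P : 'M_m)).
  rewrite Aalpha_gjoin_complete // /char_poly /char_poly_mx map_block_mx scalar_mx_block.
  rewrite opp_block_mx add_block_mx !add0r !map_const_mx -!raddfN /=.
  congr (\det (block_mx _ _ _ _)).
  apply/matrixP => i j; rewrite !mxE polyCN polyCD polyCMn /x mulrnBl; ring.
have rowP i : \sum_k char_poly_mx (Aalpha alpha e + (alpha * m%:R)%:M) i k = p.
  have : \sum_k (Aalpha alpha e + (alpha * m%:R)%:M) i k = deg_join.
    transitivity (\sum_k (Aalpha alpha e i k + (alpha * m%:R) *+ (i == k))).
      by apply: eq_bigr => k _; rewrite mxE; congr (_ + _); rewrite mxE.
    rewrite big_split /= row_sum_Aalpha er (bigD1 i) //= eqxx big1 ?addr0 //.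
    by move=> k; rewrite eq_sym => /negbTE ->.
  move: (_ + _) => N rowN.
  transitivity (\sum_k ('X *+ (i == k) - (N i k)%:P)).
    by apply: eq_bigr => k _; rewrite !mxE.
  rewrite sumrB -(rmorph_sum (@polyC R)) /= rowN (bigD1 i) //= eqxx big1 ?addr0 //.
  by move=> k; rewrite eq_sym => /negbTE ->.
have p0 : p != 0 by rewrite polyXsubC_eq0.
have px0 : p * x != 0 by rewrite mulf_neq0 ?polyXsubC_eq0.
(* These are the extra factors carried by [det_bordered] and [det_scalar_sub_const]. *)
apply: (mulfI (expf_neq0 m.-1 p0)); apply: (mulfI px0).
have := det_bordered m (1 - alpha)%:P x rowP.
move/(congr1 ( *%R (p * x))); rewrite [in RHS]mulrCA det_scalar_sub_const.
set D := \det _; set E := \det _.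
rewrite -[char_poly _]/E -(prednK m_gt0) !exprS prednK // exprMn => H.
rewrite /quotient_poly -/p -/x.
transitivity (p * x * (D * (p * p ^+ m.-1))); first by ring.
rewrite {}H.
rewrite !polyCM !polyC_natr natrM; ring.
Qed.
End JoinComplete.

(** * Dominating vertices *)

Lemma sum_single (V : nmodType) (I : finType) (f : I -> V) i0 :
  (forall i, i != i0 -> f i = 0) -> \sum_i f i = f i0.
Proof. by move=> f0; rewrite (bigD1 i0) //= big1 ?addr0. Qed.

Lemma sum_pair (V : nmodType) (I : finType) (f : I -> V) i0 i1 : i1 != i0 ->
  (forall i, i != i0 -> i != i1 -> f i = 0) -> \sum_i f i = f i0 + f i1.
Proof.
move=> i10 f0; rewrite (bigD1 i0) //= (bigD1 i1) //= big1 ?addr0 // => i /andP [? ?].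
exact: f0.
Qed.

(* In an eigenbasis of B, with eigenvalues [l] and coordinates [c] of the all-ones
   vector, the form is that of k I + b J - B; the last two hypotheses fix the
   second and first moments of the measure with weights [c i ^+ 2]. *)
Lemma no_definite_form (R : realFieldType) (I : finType) (l c : I -> R)
    (k b a L : R) (i0 : I) :
  0 < b -> a < k -> k < L -> l i0 = L ->
  (forall w : I -> R, (exists i, w i != 0) ->
     0 < \sum_i (k - l i) * w i ^+ 2 + b * (\sum_i c i * w i) ^+ 2) ->
  \sum_i c i ^+ 2 * ((l i - a) * (l i - L)) = 0 ->
  b * \sum_i c i ^+ 2 * (l i + k - a - L) = (k - a) * (L - k) -> False.
Proof.
move=> b_gt0 ak kL li0 posQ mom2 mom1.
(* Otherwise the basis vector at [i0] gives the form the value k - L < 0. *)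
have c0 : c i0 != 0.
  apply/eqP => c0.
  have := posQ (fun i => (i == i0)%:R); rewrite (sum_single (i0 := i0)); last first.
    by move=> i /negbTE ->; rewrite expr0n mulr0.
  rewrite (sum_single (i0 := i0)); last by move=> i /negbTE ->; rewrite mulr0.
  rewrite eqxx li0 c0 => /(_ _)/wrap[]; first by exists i0; rewrite eqxx oner_eq0.
  by rewrite mulr1n; lra.
(* If [k <= l i], the combination of the basis vectors at [i0] and [i] that is orthogonal to [c]
   makes the form nonpositive. *)
have lt_k i : i != i0 -> l i < k.
  move=> ii0; rewrite ltNge; apply/negP => kl.
  pose w j := if j == i0 then c i else if j == i then - c i0 else 0.
  have := posQ w; rewrite (sum_pair ii0); last first.
    by move=> j /negbTE j0 /negbTE ji; rewrite /w j0 ji expr0n mulr0.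
  rewrite (sum_pair ii0); last first.
    by move=> j /negbTE j0 /negbTE ji; rewrite /w j0 ji mulr0.
  rewrite /w !eqxx (negbTE ii0) li0 => /(_ _)/wrap[]; first by exists i; rewrite (negbTE ii0) eqxx oppr_eq0.
  have := sqr_ge0 (c i); have := sqr_ge0 (c i0); nra.
pose F := \sum_(i | i != i0) c i ^+ 2 / (k - l i).
pose G := F + b^-1.
have F_ge0 : 0 <= F.
  by apply: sumr_ge0 => i /lt_k ?; rewrite divr_ge0 ?sqr_ge0 // subr_ge0 ltW.
have G_gt0 : 0 < G by rewrite ltr_wpDl // invr_gt0.
(* The integral of 1/(x - k) is at most 1/b; each summand of S is the weighted
   gap, up to a positive factor, between it and the interpolating quadratic. *)
have EG : c i0 ^+ 2 <= G * (L - k).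
  have S_ge0 : 0 <= \sum_i c i ^+ 2 * ((l i - a) * (l i - L) * (a - l i) / ((l i - k) * (a - k))).
    apply: sumr_ge0 => i _; rewrite mulr_ge0 ?sqr_ge0 //.
    have [->|/lt_k lk] := eqVneq i i0; first by rewrite li0 subrr mulr0 !mul0r.
    apply: divr_ge0; last by nra.
    have -> : (l i - a) * (l i - L) * (a - l i) = (l i - a) ^+ 2 * (L - l i) by ring.
    by rewrite mulr_ge0 ?sqr_ge0 //; lra.
  (* Partial fractions split each summand into a linear term, a multiple of (x - a)(x - L) and a
     multiple of 1/(k - x); [mom1] evaluates the first sum and [mom2] cancels the second. *)
  have SE : \sum_i c i ^+ 2 * ((l i - a) * (l i - L) * (a - l i) / ((l i - k) * (a - k))) =
     \sum_i c i ^+ 2 * (l i + k - a - L) + (k - a)^-1 * (\sum_i c i ^+ 2 * ((l i - a) * (l i - L)))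
       + (k - a) * (L - k) * (F - c i0 ^+ 2 / (L - k)).
    have -> : F - c i0 ^+ 2 / (L - k) = \sum_i c i ^+ 2 / (k - l i).
      rewrite [RHS](bigD1 i0) //= li0 addrC; congr (_ + _).
      by rewrite -[k - L]opprB invrN mulrN.
    rewrite !mulr_sumr -!big_split /=; apply: eq_bigr => i _.
    field; rewrite !subr_eq0 (gt_eqF ak) (lt_eqF ak) /= ?andbT.
    by have [->|/lt_k lk] := eqVneq i i0; rewrite ?li0 ?(gt_eqF kL) ?(lt_eqF kL) ?(lt_eqF lk) ?(gt_eqF lk).
  move: S_ge0; rewrite SE mom2 mulr0 addr0.
  have -> : \sum_i c i ^+ 2 * (l i + k - a - L) = (k - a) * (L - k) * b^-1.
    by rewrite -mom1 mulrAC mulfV ?mul1r // gt_eqF.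
  rewrite -mulrDr pmulr_rge0 ?mulr_gt0 ?subr_gt0 // addrA subr_ge0 [b^-1 + F]addrC.
  by rewrite ler_pdivrMr ?subr_gt0.
(* Off [i0] this solves the stationarity equation (k - l i) w i + b (c . w) c i = 0 with c . w =
   -1/b; the value at [i0] is chosen to achieve that c . w. By [EG] the form is then nonpositive. *)
pose w i := if i == i0 then - (G / c i0) else c i / (k - l i).
have := posQ w; rewrite (bigD1 i0) //= [\sum_i c i * _](bigD1 i0) //= /w !eqxx li0.
have -> : \sum_(i | i != i0) (k - l i) * (if i == i0 then - (G / c i0) else c i / (k - l i)) ^+ 2 = F.
  apply: eq_bigr => i ii0; rewrite (negbTE ii0); field.
  by rewrite subr_eq0 gt_eqF ?lt_k.
have -> : \sum_(i | i != i0) c i * (if i == i0 then - (G / c i0) else c i / (k - l i)) = F.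
  by apply: eq_bigr => i ii0; rewrite (negbTE ii0) mulrA expr2.
have -> : c i0 * - (G / c i0) = - G by field.
have -> : - G + F = - b^-1 by rewrite /G opprD addrAC addNr add0r.
have -> : (k - L) * (- (G / c i0)) ^+ 2 + F + b * (- b^-1) ^+ 2 = G * (c i0 ^+ 2 - G * (L - k)) / c i0 ^+ 2.
  by rewrite /G; field; rewrite c0 gt_eqF.
move=> /(_ _)/wrap[]; first by exists i0; rewrite eqxx oppr_eq0 mulf_neq0 ?invr_eq0 // gt_eqF.
rewrite ltNge => /negP; apply; rewrite pmulr_lle0 ?invr_gt0 ?exprn_even_gt0 //.
by rewrite pmulr_rle0 // subr_le0.
Qed.

Definition gcompl (n : nat) (h : rel 'I_n) : rel 'I_n := fun i j => (i != j) && ~~ h i j.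

Lemma simple_gcompl (n : nat) (h : rel 'I_n) : simple_graph h -> simple_graph (gcompl h).
Proof.
move=> [symH _]; split=> [i j|i]; last by rewrite /gcompl eqxx.
by rewrite /gcompl eq_sym symH.
Qed.

Section Dominating.
Variables (R : rcfType) (alpha : R).
Hypotheses (alpha_gt : 1 / 2 < alpha) (alpha_lt1 : alpha < 1).

Let two_alpha_gt1 : 0 < 2 * alpha - 1.
Proof. by rewrite subr_gt0 mulrC -ltr_pdivrMr. Qed.

Local Notation qf A x := ((x *m A *m x^T) 0 0).

(** A_alpha = (2 alpha - 1) D + (1 - alpha)(D + A), and the signless Laplacian D + A has the form of
    a sum of (x_i + x_j)^2 over the edges. *)
Lemma Aalpha_form_ge (n : nat) (h : rel 'I_n) (x : 'rV[R]_n) : simple_graph h ->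
  (2 * alpha - 1) * \sum_i (deg h i)%:R * x 0 i ^+ 2 <= qf (Aalpha alpha h) x.
Proof.
move=> [symH irrH].
pose a i j : R := (h i j)%:R.
have formE : qf (Aalpha alpha h) x =
    alpha * \sum_i (deg h i)%:R * x 0 i ^+ 2 + (1 - alpha) * \sum_i \sum_j a i j * (x 0 i * x 0 j).
  rewrite !mulr_sumr -big_split /= dot_rVE; apply: eq_bigr => i _.
  rewrite mxE mulr_suml mulr_sumr.
  under eq_bigr => j _ do rewrite AalphaE mulrDr mulrDl.
  rewrite big_split /= (bigD1 i) //= eqxx [X in _ + X + _]big1; last first.
    by move=> j /negbTE ->; rewrite mul0r !mulr0 mul0r.
  congr (_ + _); first by rewrite mul1r addr0; ring.
  by apply: eq_bigr => j _; rewrite /a symH; ring.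
have degS : \sum_i (deg h i)%:R * x 0 i ^+ 2 = \sum_i \sum_j a i j * x 0 i ^+ 2.
  by apply: eq_bigr => i _; rewrite degE mulr_suml.
have : 0 <= \sum_i \sum_j a i j * (x 0 i + x 0 j) ^+ 2.
  by apply: sumr_ge0 => i _; apply: sumr_ge0 => j _; rewrite mulr_ge0 ?sqr_ge0 ?ler0n.
have -> : \sum_i \sum_j a i j * (x 0 i + x 0 j) ^+ 2 =
    2 * (\sum_i (deg h i)%:R * x 0 i ^+ 2 + \sum_i \sum_j a i j * (x 0 i * x 0 j)).
  have degS' : \sum_i (deg h i)%:R * x 0 i ^+ 2 = \sum_i \sum_j a i j * x 0 j ^+ 2.
    rewrite degS exchange_big /=; apply: eq_bigr => i _; apply: eq_bigr => j _.
    by rewrite /a symH.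
  rewrite mulrDr mulr_natl mulr2n {1}degS degS' mulr_sumr -!big_split /=.
  apply: eq_bigr => i _; rewrite mulr_sumr -!big_split /=; apply: eq_bigr => j _; ring.
rewrite formE pmulr_rge0 //.
move: (\sum_i (deg h i)%:R * _) (\sum_i \sum_j _) => s t st_ge0; rewrite -subr_ge0.
have -> : alpha * s + (1 - alpha) * t - (2 * alpha - 1) * s = (1 - alpha) * (s + t) by ring.
by rewrite mulr_ge0 // subr_ge0 ltW.
Qed.

Lemma deg_gcompl (n : nat) (h : rel 'I_n) i : simple_graph h ->
  (deg (gcompl h) i)%:R = n%:R - 1 - (deg h i)%:R :> R.
Proof.
move=> [_ irrH]; rewrite !degE.
have -> : n%:R = \sum_(j < n) 1 :> R by rewrite sumr_const card_ord.
rewrite -sumrN [X in _ = X - _ + _](bigD1 i) //= [1 + _]addrC addrK.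
rewrite (bigD1 i) //= [\sum_j - _](bigD1 i) //= /gcompl eqxx (negbTE (irrH i)) oppr0 !add0r.
rewrite -big_split /=; apply: eq_bigr => j; rewrite eq_sym => ->.
by case: (h i j); rewrite ?subrr ?subr0.
Qed.

(** The degree matrices of [h] and its complement add up to (n - 1) I, the adjacency matrices to J -
    I, and alpha (n - 1) - (1 - alpha) = alpha n - 1. *)
Lemma Aalpha_gcompl (n : nat) (h : rel 'I_n) : simple_graph h ->
  Aalpha alpha (gcompl h) = (alpha * n%:R - 1)%:M + const_mx (1 - alpha) - Aalpha alpha h.
Proof.
move=> sh; apply/matrixP => i j.
transitivity ((alpha * n%:R - 1) *+ (i == j) + (1 - alpha) - Aalpha alpha h i j); last first.
  by rewrite [RHS]mxE; congr (_ + _); rewrite !mxE.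
rewrite !AalphaE deg_gcompl // /gcompl.
have [<-|ij] := eqVneq i j; first by rewrite (negbTE (sh.2 i)) !mulr1n !mulr0n; ring.
by case: (h i j); rewrite ?mulr1n ?mulr0n; ring.
Qed.

Variables (n : nat) (h : rel 'I_n) (U : 'M[R]_n) (d : 'rV[R]_n).
Hypotheses (sh : simple_graph h) (UU : U *m U^T = 1%:M).
Hypothesis AE : Aalpha alpha h = U^T *m diag_mx d *m U.

Let k := alpha * n%:R - 1.
(** The rows of [U] form the eigenbasis; these are the coordinates of the all-ones vector in it. *)
Let c i := \sum_j U i j.

(** This is [Aalpha_form_ge] for the complement, written in the eigenbasis of [h]. The left side
    vanishes only if [w *m U] is supported on the dominating vertices of [h]. *)
Lemma spectral_form_ge (w : 'rV[R]_n) :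
  (2 * alpha - 1) * \sum_j (deg (gcompl h) j)%:R * (w *m U) 0 j ^+ 2 <=
  \sum_i (k - d 0 i) * w 0 i ^+ 2 + (1 - alpha) * (\sum_i c i * w 0 i) ^+ 2.
Proof.
apply: le_trans (Aalpha_form_ge _ (simple_gcompl sh)) _.
rewrite Aalpha_gcompl // -/k.
set x := w *m U.
have addE (X Y : 'M[R]_1) : (X + Y) 0 0 = X 0 0 + Y 0 0 by rewrite mxE.
have oppE (X : 'M[R]_1) : (- X) 0 0 = - X 0 0 by rewrite mxE.
have xU : x *m U^T = w by rewrite /x -mulmxA UU mulmx1.
have Ux : U *m x^T = w^T by rewrite -xU [RHS]trmx_mul trmxK.
rewrite mulmxBr mulmxDr mulmxBl mulmxDl 2!addE oppE.
have -> : qf k%:M x = \sum_i k * w 0 i ^+ 2.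
  rewrite mul_mx_scalar -scalemxAl mxE -mulr_sumr; congr (_ * _).
  by rewrite /x trmx_mul mulmxA xU dot_rVE; apply: eq_bigr => i _; rewrite expr2.
have -> : qf (Aalpha alpha h) x = \sum_i d 0 i * w 0 i ^+ 2.
  rewrite AE !mulmxA xU -mulmxA Ux dot_rVE.
  by apply: eq_bigr => i _; rewrite mul_mx_diag mxE; ring.
have -> : qf (const_mx (1 - alpha)) x = (1 - alpha) * (\sum_i c i * w 0 i) ^+ 2.
  have sx : \sum_i c i * w 0 i = \sum_j x 0 j.
    rewrite /c; under eq_bigr => i _ do rewrite mulr_suml.
    rewrite exchange_big /=; apply: eq_bigr => j _.
    by rewrite /x mxE; apply: eq_bigr => i _; rewrite mulrC.
  rewrite sx; move: x {xU Ux sx} => y.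
  rewrite dot_rVE expr2 mulr_sumr mulr_sumr; apply: eq_bigr => j _.
  rewrite mxE; under eq_bigr => i _ do rewrite mxE.
  by rewrite -mulr_suml; ring.
by rewrite addrAC -sumrB lerD2r; apply: ler_sum => i _; rewrite [leRHS]mulrBl.
Qed.

Lemma isolated_gcompl i : (deg (gcompl h) i == 0)%N = (deg h i == n.-1).
Proof.
rewrite -(eqr_nat R) (deg_gcompl i sh) -(eqr_nat R).
have : n%:R = n.-1%:R + 1 :> R by rewrite natr1 prednK // (leq_ltn_trans _ (ltn_ord i)).
by move=> ->; rewrite addrK subr_eq0 eq_sym.
Qed.

Lemma row_const_mul_tr (X : 'M[R]_n) j : ((const_mx 1 : 'rV[R]_n) *m X^T) 0 j = \sum_i X j i.
Proof. by rewrite mxE; apply: eq_bigr => i _; rewrite !mxE mul1r. Qed.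

(** The products 1 . 1, 1 . B1 and B1 . B1 are each computed in the standard basis and in the
    eigenbasis. *)
Lemma spectral_moments :
  [/\ \sum_i c i ^+ 2 = n%:R, \sum_i c i ^+ 2 * d 0 i = \sum_i (deg h i)%:R &
      \sum_i c i ^+ 2 * d 0 i ^+ 2 = \sum_i (deg h i)%:R ^+ 2].
Proof.
pose u : 'rV[R]_n := const_mx 1; pose v := u *m U^T; pose B := Aalpha alpha h.
have cE i : v 0 i = c i by rewrite /v row_const_mul_tr.
have degB j : (u *m B) 0 j = (deg h j)%:R.
  by rewrite -(row_sum_Aalpha alpha) -row_const_mul_tr Aalpha_sym.
have uB : u *m B = v *m diag_mx d *m U by rewrite /B AE !mulmxA.
have vU : v *m U = u by rewrite /v -mulmxA (mulmx1C UU) mulmx1.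
have Uu : U *m u^T = v^T by rewrite /v trmx_mul trmxK.
split.
- transitivity ((v *m v^T) 0 0).
    by rewrite dot_rVE; apply: eq_bigr => i _; rewrite cE expr2.
  rewrite /v trmx_mul trmxK mulmxA -[u *m _ *m _]mulmxA (mulmx1C UU) mulmx1 dot_rVE.
  under eq_bigr => i _ do rewrite !mxE mulr1.
  by rewrite sumr_const card_ord.
- transitivity ((u *m B *m u^T) 0 0); last first.
    by rewrite dot_rVE; apply: eq_bigr => i _; rewrite degB mxE mulr1.
  rewrite uB -mulmxA Uu dot_rVE; apply: eq_bigr => i _.
  by rewrite mul_mx_diag mxE cE; ring.
transitivity ((u *m B *m (u *m B)^T) 0 0); last first.
  by rewrite dot_rVE; apply: eq_bigr => i _; rewrite degB expr2.
rewrite uB [(_ *m U)^T]trmx_mul mulmxA -[_ *m U *m U^T]mulmxA UU mulmx1 dot_rVE.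
by apply: eq_bigr => i _; rewrite mul_mx_diag mxE cE; ring.
Qed.

Lemma eigenvalue_index L : root (char_poly (Aalpha alpha h)) L -> exists i, d 0 i = L.
Proof.
rewrite AE char_poly_conj // char_poly_diag root_prod_XsubC => /codomP [i ->].
by exists i.
Qed.

(** Without a dominating vertex all degrees in the complement are positive, so [spectral_form_ge]
    makes the form positive definite and [no_definite_form] applies. The two equations prescribe the
    integrals of (x - a)(x - L) and of x + k - a - L. *)
Lemma dominating_exists a L : a < k -> k < L -> root (char_poly (Aalpha alpha h)) L ->
  \sum_i (deg h i)%:R ^+ 2 - (a + L) * \sum_i (deg h i)%:R + a * L * n%:R = 0 ->
  (1 - alpha) * (\sum_i (deg h i)%:R + (k - a - L) * n%:R) = (k - a) * (L - k) ->
  exists i, deg h i = n.-1.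
Proof.
move=> ak kL /eigenvalue_index [i0 di0] mom2 mom1.
have [m0 m1 m2] := spectral_moments.
have [/existsP [i /eqP ?]|noD] := boolP [exists i, deg h i == n.-1]; first by exists i.
have degc_gt0 i : 0 < (deg (gcompl h) i)%:R :> R.
  rewrite ltr0n lt0n isolated_gcompl; apply: contra noD => ?; by apply/existsP; exists i.
exfalso; apply: (@no_definite_form R _ (d 0) c k (1 - alpha) a L i0) => //.
- by rewrite subr_gt0.
- move=> w [i wi].
  pose w' : 'rV[R]_n := \row_j w j.
  have : 0 < (2 * alpha - 1) * \sum_j (deg (gcompl h) j)%:R * (w' *m U) 0 j ^+ 2.
    rewrite mulr_gt0 //.
    have /rV0Pn [j xj] : w' *m U != 0.
      apply: contra wi => /eqP wU0.
      have : w' *m U *m U^T = 0 by rewrite wU0 mul0mx.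
      by rewrite -mulmxA UU mulmx1 => /rowP /(_ i); rewrite !mxE => ->.
    rewrite (bigD1 j) //= ltr_wpDr //; last by rewrite mulr_gt0 // exprn_even_gt0.
    by apply: sumr_ge0 => t _; rewrite mulr_ge0 ?sqr_ge0 // ltW.
  move/lt_le_trans => /(_ _ (spectral_form_ge w')).
  by under eq_bigr => j _ do rewrite mxE; under [in X in _ + X]eq_bigr => j _ do rewrite mxE.
- transitivity (\sum_i (c i ^+ 2 * d 0 i ^+ 2 - (a + L) * (c i ^+ 2 * d 0 i) + a * L * c i ^+ 2)).
    by apply: eq_bigr => i _; ring.
  by rewrite big_split sumrB /= -!mulr_sumr m0 m1 m2.
rewrite -mom1 -m0 -m1; congr (_ * _).
by rewrite mulr_sumr -big_split; apply: eq_bigr => i _ /=; ring.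
Qed.

Lemma kappa_eigenvector i L : k < L -> root (char_poly (Aalpha alpha h)) L -> d 0 i = k ->
  c i = 0 /\ forall j, deg h j <> n.-1 -> U i j = 0.
Proof.
move=> kL /eigenvalue_index [i0 di0] dik.
have ii0 : i != i0 by apply/eqP => ii0; move: kL; rewrite -di0 -ii0 dik ltxx.
have form_ge0 (w : 'rV[R]_n) : 0 <= (2 * alpha - 1) * \sum_j (deg (gcompl h) j)%:R * (w *m U) 0 j ^+ 2.
  rewrite mulr_ge0 ?(ltW two_alpha_gt1) //.
  by apply: sumr_ge0 => j _; rewrite mulr_ge0 ?sqr_ge0 ?ler0n.
have formE x y : let w := x *: delta_mx 0 i + y *: delta_mx 0 i0 : 'rV[R]_n in
    \sum_i (k - d 0 i) * w 0 i ^+ 2 + (1 - alpha) * (\sum_i c i * w 0 i) ^+ 2 =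
    (k - L) * y ^+ 2 + (1 - alpha) * (c i * x + c i0 * y) ^+ 2.
  rewrite /= (sum_pair ii0); last first.
    by move=> j /negbTE j0 /negbTE ji; rewrite !mxE j0 ji !andbF !mulr0n; ring.
  rewrite (sum_pair ii0); last first.
    by move=> j /negbTE j0 /negbTE ji; rewrite !mxE j0 ji !andbF !mulr0n; ring.
  by rewrite !mxE !eqxx /= eq_sym (negbTE ii0) dik di0 mulr1n mulr0n; ring.
have ci : c i = 0.
  (* This vector is orthogonal to the all-ones vector, so the form reduces to (k - L) (c i)^2, which
     must be nonnegative. *)
  have := le_trans (form_ge0 _) (spectral_form_ge (c i0 *: delta_mx 0 i + (- c i) *: delta_mx 0 i0)).
  rewrite formE mulrN [c i0 * _]mulrC subrr expr0n mulr0 addr0 sqrrN.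
  rewrite nmulr_rge0 ?subr_lt0 // => ?.
  by apply/eqP; rewrite -sqrf_eq0 eq_le sqr_ge0 andbT.
split=> // j /eqP dj.
(* At the eigenvector itself the form is now 0, so every weighted square on the left vanishes. *)
have := spectral_form_ge (1 *: delta_mx 0 i + 0 *: delta_mx 0 i0).
rewrite formE ci mul0r mulr0 addr0 expr0n !mulr0 addr0 scale1r scale0r addr0 -rowE.
rewrite pmulr_rle0 //.
move=> le0; have /psumr_eq0P : \sum_j (deg (gcompl h) j)%:R * row i U 0 j ^+ 2 = 0.
  apply/eqP; rewrite eq_le le0; apply: sumr_ge0 => t _; by rewrite mulr_ge0 ?sqr_ge0 ?ler0n.
move=> /(_ _)/wrap[t _|/(_ j isT)/eqP]; first by rewrite mulr_ge0 ?sqr_ge0 ?ler0n.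
by rewrite mulf_eq0 pnatr_eq0 isolated_gcompl (negbTE dj) /= sqrf_eq0 mxE => /eqP.
Qed.

(** Restricted to the dominating vertices, the k-eigenvectors in [U] stay orthonormal and are
    orthogonal to the all-ones vector, which is nonzero there; this costs one dimension and makes
    the inequality strict. *)
Lemma dominating_count L : k < L -> root (char_poly (Aalpha alpha h)) L ->
  (exists i, deg h i = n.-1) ->
  (spectrum (Aalpha alpha h) k < #|[set i | deg h i == n.-1]|)%N.
Proof.
move=> kL rootL [i0 di0].
pose K := [set i | d 0 i == k]; pose D := [set i | deg h i == n.-1].
have -> : spectrum (Aalpha alpha h) k = #|K|.
  rewrite /spectrum AE char_poly_conj // char_poly_diag mu_prod_XsubC codomE count_map.
  rewrite -size_filter enumT cardE /enum_mem; congr size.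
  by apply: eq_filter => i; rewrite !inE.
pose W : 'M[R]_(#|K|, #|D|) := \matrix_(s, t) U (enum_val s) (enum_val t).
have KW (s : 'I_#|K|) := @kappa_eigenvector (enum_val s) L kL rootL.
have dK (s : 'I_#|K|) : d 0 (enum_val s) = k by have := enum_valP s; rewrite inE => /eqP.
have sumD (f : 'I_n -> R) : (forall j, deg h j <> n.-1 -> f j = 0) ->
    \sum_(t < #|D|) f (enum_val t) = \sum_j f j.
  move=> f0; rewrite -(big_enum_val f) [RHS](bigID (mem D)) /=.
  by rewrite [X in _ + X]big1 ?addr0 // => j; rewrite inE => /eqP /f0.
have freeW : row_free W.
  apply/row_freeP; exists W^T; apply/matrixP => s s'.
  have := congr1 (fun X : 'M[R]_n => X (enum_val s) (enum_val s')) UU.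
  rewrite !mxE (inj_eq enum_val_inj) => <-.
  under eq_bigr => t _ do rewrite !mxE.
  rewrite (sumD (fun j => U (enum_val s) j * U (enum_val s') j)).
    by apply: eq_bigr => j _; rewrite mxE.
  by move=> j /((KW s (dK s)).2) ->; rewrite mul0r.
have W1 : W *m (const_mx 1 : 'cV[R]_#|D|) = 0.
  apply/matrixP => s t; rewrite !mxE.
  under eq_bigr => j _ do rewrite !mxE mulr1.
  by rewrite (sumD (U (enum_val s))); [exact: (KW s (dK s)).1 | exact: (KW s (dK s)).2].
have := mulmx0_rank_max W1; rewrite (eqP freeW); apply: leq_trans.
rewrite -addn1 leq_add2l lt0n mxrank_eq0; apply/eqP => /matrixP.
have i0D : i0 \in D by rewrite inE di0.
by move=> /(_ (enum_rank_in i0D i0) 0); rewrite !mxE => /eqP; rewrite oner_eq0.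
Qed.
End Dominating.

(** * Isomorphisms *)

Lemma graph_iso_trans (n p q : nat) (e : rel 'I_n) (f : rel 'I_p) (g : rel 'I_q) :
  graph_iso e f -> graph_iso f g -> graph_iso e g.
Proof.
move=> [u [bu eu]] [v [bv ev]]; exists (v \o u); split; first exact: bij_comp.
by move=> i j; rewrite /= ev eu.
Qed.

Lemma graph_iso_gjoin (n p m : nat) (e : rel 'I_n) (e' : rel 'I_p) (f : rel 'I_m) :
  graph_iso e e' -> graph_iso (gjoin e f) (gjoin e' f).
Proof.
move=> [u [[v uK vK] eu]].
pose ext q s (w : 'I_q -> 'I_s) (x : 'I_(q + m)) : 'I_(s + m) :=
  match split x with inl a => lshift m (w a) | inr b => rshift s b end.
have extl q s (w : 'I_q -> 'I_s) i : ext q s w (lshift m i) = lshift m (w i).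
  by rewrite /ext (unsplitK (inl _)).
have extr q s (w : 'I_q -> 'I_s) i : ext q s w (rshift q i) = rshift s i.
  by rewrite /ext (unsplitK (inr _)).
exists (ext _ _ u); split.
  by exists (ext _ _ v) => x; case: (split_ordP x) => i ->; rewrite ?extl ?extr ?uK ?vK.
move=> x y; case: (split_ordP x) => i ->; case: (split_ordP y) => j ->;
  by rewrite ?extl ?extr !gjoinE.
Qed.

Lemma graph_iso_deg (n p : nat) (e : rel 'I_n) (h : rel 'I_p) (u : 'I_n -> 'I_p) :
  bijective u -> (forall i j, h (u i) (u j) = e i j) -> forall i, deg h (u i) = deg e i.
Proof.
move=> bu eu i; rewrite /deg -(card_imset _ (bij_inj bu)); apply: eq_card => j.
have [v uK vK] := bu; rewrite inE; apply/idP/imsetP => [hj|[k]].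
  by exists (v j); rewrite ?vK // inE -eu vK.
by rewrite inE => ek ->; rewrite eu.
Qed.

Lemma graph_iso_char_poly (R : rcfType) (alpha : R) (n : nat) (e h : rel 'I_n) :
  graph_iso e h -> char_poly (Aalpha alpha e) = char_poly (Aalpha alpha h).
Proof.
move=> [u [bu eu]]; pose s := perm (bij_inj bu).
have -> : Aalpha alpha e = perm_mx s *m Aalpha alpha h *m perm_mx s^-1%g.
  rewrite -row_permE -col_permE; apply/matrixP => i j.
  transitivity (Aalpha alpha h (s i) (s j)); last by rewrite [RHS]mxE [RHS]mxE.
  by rewrite !AalphaE (inj_eq perm_inj) !permE (graph_iso_deg bu eu) eu.
by apply: char_poly_conj; rewrite -perm_mxM mulVg perm_mx1.
Qed.

Lemma dominating_adj (n : nat) (h : rel 'I_n) i j :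
  simple_graph h -> deg h i = n.-1 -> h i j = (i != j).
Proof.
move=> [_ irrH] di.
have /eqP /setP /(_ j) : [set j | h i j] == [set~ i].
  rewrite eqEcard cardsC1 card_ord -di leqnn andbT; apply/subsetP => k.
  by rewrite !inE; apply: contraTneq => ->.
by rewrite !inE eq_sym.
Qed.

(** Exactly [m] dominating vertices are picked to form K_m, even if there are more; [e] is induced
    on the remaining [n]. *)
Lemma split_dominating (n m : nat) (h : rel 'I_(n + m)) : simple_graph h ->
  (m <= #|[set i | deg h i == (n + m).-1]|)%N ->
  exists e : rel 'I_n, simple_graph e /\ graph_iso (gjoin e (complete m)) h.
Proof.
move=> sh /card_geqP [s [us szs sD]].
pose S := [set x in s].
have cS : #|S| = m by rewrite cardsE (card_uniqP us).
have cSC : #|~: S| = n.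
  by apply/eqP; rewrite -(eqn_add2l #|S|) cardsC card_ord cS addnC.
pose f (x : 'I_(n + m)) : 'I_(n + m) :=
  match split x with
  | inl a => enum_val (cast_ord (esym cSC) a)
  | inr b => enum_val (cast_ord (esym cS) b)
  end.
have fl i : f (lshift m i) = enum_val (cast_ord (esym cSC) i).
  by rewrite /f (unsplitK (inl _)).
have fr i : f (rshift n i) = enum_val (cast_ord (esym cS) i).
  by rewrite /f (unsplitK (inr _)).
have flS i : f (lshift m i) \notin S by rewrite fl -in_setC enum_valP.
have frS i : f (rshift n i) \in S by rewrite fr enum_valP.
have injf : injective f.
  move=> x y; case: (split_ordP x) => i ->; case: (split_ordP y) => j ->.
  - by rewrite !fl => /enum_val_inj /cast_ord_inj ->.
  - by move=> E; have := flS i; rewrite E frS.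
  - by move=> E; have := flS j; rewrite -E frS.
  - by rewrite !fr => /enum_val_inj /cast_ord_inj ->.
have domr i : deg h (f (rshift n i)) = (n + m).-1.
  by have := frS i; rewrite inE => /sD; rewrite inE => /eqP.
exists (fun i j => h (f (lshift m i)) (f (lshift m j))); split.
  by split=> [i j|i]; [apply: sh.1 | apply: sh.2].
exists f; split; first exact: injF_bij.
move=> x y; case: (split_ordP x) => i ->; case: (split_ordP y) => j ->; rewrite gjoinE //.
- by rewrite sh.1 dominating_adj // (inj_eq injf) eq_rlshift.
- by rewrite dominating_adj // (inj_eq injf) eq_rlshift.
- by rewrite dominating_adj // (inj_eq injf) (inj_eq (@rshift_inj _ _)).
Qed.

(** If r = n - 1, both graphs are complete. Otherwise degree r + m differs from n + m - 1, so the
    isomorphism maps the first side to the first side. *)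
Lemma gjoin_complete_cancel (n m r : nat) (e h : rel 'I_n) :
  simple_graph e -> simple_graph h -> regular r e -> regular r h ->
  graph_iso (gjoin e (complete m)) (gjoin h (complete m)) -> graph_iso e h.
Proof.
move=> se sh er hr [F [bF eF]].
have [rn|rn] := eqVneq r n.-1.
  exists id; split; first by exists id.
  by move=> i j; rewrite (dominating_adj j se) ?(dominating_adj j sh) ?er ?hr.
have degF := graph_iso_deg bF eF.
have Fl i : exists j, F (lshift m i) = lshift m j.
  case: (split_ordP (F (lshift m i))) => j Ej; first by exists j.
  have := degF (lshift m i); rewrite Ej deg_gjoin_complete_r deg_gjoin_l er.
  by move: rn; have := ltn_ord i; lia.
have [g Fg] := fin_all_exists Fl.
exists g; split; last by move=> i j; rewrite -(gjoin_ll e (complete m)) -eF !Fg gjoinE.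
apply: injF_bij => i j gij; apply: (@lshift_inj _ m); apply: (bij_inj bF).
by rewrite !Fg gij.
Qed.

(** * Graphs cospectral to a join *)

Lemma quadratic_roots_around (R : rcfType) (t d k : R) :
  k ^+ 2 - t * k + d < 0 ->
  exists a L, [/\ a < k, k < L, a + L = t & a * L = d].
Proof.
move=> qk; set D := t ^+ 2 - 4 * d.
(* The difference is -4 times the value of the quadratic at [k]. *)
have D_gt : (t - 2 * k) ^+ 2 < D.
  rewrite -subr_gt0 /D.
  have -> : t ^+ 2 - 4 * d - (t - 2 * k) ^+ 2 = - 4 * (k ^+ 2 - t * k + d) by ring.
  by rewrite nmulr_rgt0 // oppr_lt0.
have D_gt0 : 0 < D by apply: le_lt_trans D_gt; exact: sqr_ge0.
have s2 : Num.sqrt D ^+ 2 = D by rewrite sqr_sqrtr // ltW.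
have : `|t - 2 * k| < Num.sqrt D by rewrite -sqrtr_sqr ltr_sqrt.
move: s2; set s := Num.sqrt D => s2; rewrite ltr_norml => /andP [lt1 lt2].
exists ((t - s) / 2), ((t + s) / 2); split.
- lra.
- lra.
- by field.
have -> : (t - s) / 2 * ((t + s) / 2) = (t ^+ 2 - s ^+ 2) / 4 by field.
by rewrite s2 /D; field.
Qed.

Section JoinSpectrum.
Variables (n m r : nat) (R : rcfType) (alpha : R).
Hypotheses (alpha_gt : 1 / 2 < alpha) (alpha_lt1 : alpha < 1) 
  (n_gt0 : (0 < n)%N) (m_gt0 : (0 < m)%N).
Implicit Types e : rel 'I_n.

Local Notation kap := (kappa n m alpha).
Local Notation p0 := (deg_join m alpha r).
Local Notation join e := (gjoin e (complete m)).

Let XsubC_neq0 (c : R) : 'X - c%:P != 0.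
Proof. by rewrite polyXsubC_eq0. Qed.

Lemma alpha_neq0 : alpha != 0.
Proof. by rewrite gt_eqF //; apply: lt_trans alpha_gt; rewrite divr_gt0. Qed.

Lemma sum_deg_gjoin e k :
  \sum_i (deg (join e) i)%:R ^+ k =
  \sum_i ((deg e i)%:R + m%:R) ^+ k + m%:R * (n + m).-1%:R ^+ k :> R.
Proof.
rewrite big_split_ord /=; congr (_ + _).
  by apply: eq_bigr => i _; rewrite deg_gjoin_l natrD.
under eq_bigr => i _ do rewrite deg_gjoin_complete_r.
by rewrite sumr_const card_ord mulr_natl.
Qed.

Lemma predn_natr : (n + m).-1%:R = n%:R + m%:R - 1 :> R.
Proof. by rewrite -natrD -[in RHS](@prednK (n + m)) ?addn_gt0 ?m_gt0 ?orbT // -natr1 addrK. Qed.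

(** The value there is -(1 - alpha)^2 n m. Hence [quotient_poly] is nonzero, and its roots survive
    cancelling ['X - p0%:P] in [char_poly_gjoin]. *)
Lemma quotient_poly_deg_join : ~~ root (quotient_poly n m alpha r) p0.
Proof.
rewrite /root /quotient_poly !hornerE subrr mul0r add0r oppr_eq0 mulf_eq0 expf_eq0 /=.
by rewrite subr_eq0 gt_eqF //= pnatr_eq0 muln_eq0 !gtn_eqF.
Qed.

Lemma char_poly_gjoin_inj e e' : simple_graph e -> simple_graph e' ->
  regular r e -> regular r e' ->
  char_poly (Aalpha alpha (join e)) = char_poly (Aalpha alpha (join e')) <->
  char_poly (Aalpha alpha e) = char_poly (Aalpha alpha e').
Proof.
move=> se se' er er'.
have q0 : quotient_poly n m alpha r != 0.
  by apply: contra quotient_poly_deg_join => /eqP ->; rewrite root0.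
have := char_poly_gjoin alpha se er m_gt0; have := char_poly_gjoin alpha se' er' m_gt0.
move=> E' E; split=> eqC.
  apply: (@char_poly_addC_inj _ _ _ _ _ (alpha * m%:R)).
  apply: (mulIf (expf_neq0 m.-1 (XsubC_neq0 kap))); apply: (mulIf q0).
  by rewrite -E -E' eqC.
apply: (mulfI (XsubC_neq0 p0)); rewrite E E'.
by rewrite !char_poly_addC eqC.
Qed.

(** The factor ['X - p0%:P] is cancelled inside the polynomial of G, where the all-ones vector
    supplies the root; the power of ['X - kap%:P] stays whole even if p0 = kap. *)
Lemma kappa_multiplicity e : simple_graph e -> regular r e ->
  (m.-1 <= spectrum (Aalpha alpha (join e)) kap)%N.
Proof.
move=> se er.
have /factor_theorem [g Eg] : root (char_poly (Aalpha alpha e + (alpha * m%:R)%:M)) p0.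
  rewrite -eigenvalue_root_char; apply/eigenvalueP; exists (const_mx 1).
    rewrite mulmxDr mul_mx_scalar /deg_join scalerDl; congr (_ + _).
    apply/rowP => j; rewrite -{1}(Aalpha_sym alpha se) row_const_mul_tr row_sum_Aalpha er.
    by rewrite !mxE mulr1.
  apply/eqP => /rowP /(_ (Ordinal n_gt0)); rewrite !mxE => /eqP.
  by rewrite oner_eq0.
have E : char_poly (Aalpha alpha (join e)) =
    g * ('X - kap%:P) ^+ m.-1 * quotient_poly n m alpha r.
  apply: (mulfI (XsubC_neq0 p0)).
  by rewrite (char_poly_gjoin alpha se er m_gt0) Eg; ring.
rewrite /spectrum mup_geq ?monic_neq0 ?char_poly_monic // E.
by rewrite dvdp_mulr // dvdp_mull.
Qed.

Lemma gjoin_main_eigenvalues e : simple_graph e -> regular r e -> (r < n.-1)%N ->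
  exists a L, [/\ a < kap, kap < L, root (char_poly (Aalpha alpha (join e))) L,
    a + L = p0 + kap + (1 - alpha) * m%:R &
    a * L = p0 * (kap + (1 - alpha) * m%:R) - (1 - alpha) ^+ 2 * (n * m)%:R].
Proof.
move=> se er rn.
have qk : kap ^+ 2 - (p0 + kap + (1 - alpha) * m%:R) * kap +
    (p0 * (kap + (1 - alpha) * m%:R) - (1 - alpha) ^+ 2 * (n * m)%:R) < 0.
  (* The quotient polynomial at [kap] is -(1 - alpha) m (n - 1 - r), negative exactly because G is
     not complete; so [kap] separates its roots. *)
  rewrite [X in X < 0](_ : _ = - ((1 - alpha) * m%:R * (n%:R - 1 - r%:R))).
    rewrite oppr_lt0 !mulr_gt0 ?subr_gt0 ?ltr0n //.
    by rewrite ltrBrDr natr1 ltr_nat; move: rn; lia.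
  by rewrite /kappa /deg_join natrD natrM; ring.
have [a [L [ak kL aDL aML]]] := quadratic_roots_around qk.
exists a, L; split=> //.
have qE : quotient_poly n m alpha r = ('X - a%:P) * ('X - L%:P).
  transitivity ('X ^+ 2 - (a + L)%:P * 'X + (a * L)%:P); last by rewrite polyCD polyCM; ring.
  by rewrite aDL aML /quotient_poly !(polyCD, polyCB, polyCM); ring.
have qL : root (quotient_poly n m alpha r) L.
  by rewrite qE rootM !root_XsubC eqxx orbT.
have : root (('X - p0%:P) * char_poly (Aalpha alpha (join e))) L.
  by rewrite (char_poly_gjoin alpha se er m_gt0) rootM qL orbT.
rewrite rootM root_XsubC => /orP [/eqP Lp|//].
by move: quotient_poly_deg_join; rewrite -Lp qL.
Qed.

Lemma cospectral_dominating e (h : rel 'I_(n + m)) :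
  simple_graph e -> regular r e -> (r <= n.-1)%N -> simple_graph h ->
  char_poly (Aalpha alpha (join e)) = char_poly (Aalpha alpha h) ->
  (m <= #|[set i | deg h i == (n + m).-1]|)%N.
Proof.
move=> se er rn sh eqC.
have sj := simple_gjoin se (simple_complete m).
have [S1 S2] := char_poly_degree_sums alpha_neq0 sj sh eqC.
have T1 := sum_deg_gjoin e 1; have T2 := sum_deg_gjoin e 2.
move: S1 S2 T1 T2.
have -> : \sum_i ((deg e i)%:R + m%:R) ^+ 1 = n%:R * (r%:R + m%:R) :> R.
  by under eq_bigr => i _ do rewrite er; rewrite sumr_const card_ord mulr_natl.
have -> : \sum_i ((deg e i)%:R + m%:R) ^+ 2 = n%:R * (r%:R + m%:R) ^+ 2 :> R.
  by under eq_bigr => i _ do rewrite er; rewrite sumr_const card_ord mulr_natl.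
rewrite !expr1 => S1 S2 T1 T2.
have {}S1 : \sum_i (deg h i)%:R = n%:R * (r%:R + m%:R) + m%:R * (n + m).-1%:R :> R.
  by rewrite -S1 -T1; apply: eq_bigr => i _; rewrite expr1.
have {}S2 : \sum_i (deg h i)%:R ^+ 2 = n%:R * (r%:R + m%:R) ^+ 2 + m%:R * (n + m).-1%:R ^+ 2 :> R.
  by rewrite -S2 -T2.
(* For r = n - 1 the join is complete, [kap] is itself a root of the quotient polynomial, and the
   degree sums alone make every vertex of [h] dominating. *)
move: rn; rewrite leq_eqVlt => /orP [/eqP rn|rn].
  have rm : r%:R + m%:R = (n + m).-1%:R :> R by rewrite -natrD rn; congr _%:R; lia.
  have hr : regular (n + m).-1 h.
    by apply: (@regular_of_degree_sums R); rewrite ?S1 ?S2 rm natrD; ring.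
  rewrite [X in (_ <= X)%N](_ : _ = n + m)%N ?leq_addl //.
  by rewrite -[RHS]card_ord -cardsT; apply: eq_card => i; rewrite !inE hr eqxx.
have [a [L [ak kL rootL aDL aML]]] := gjoin_main_eigenvalues se er rn.
have [U [d [UU AE]]] := symmetric_spectral (Aalpha_sym alpha sh).
rewrite eqC in rootL.
have mult := kappa_multiplicity se er.
have DE : exists i, deg h i = (n + m).-1.
  (* The degree sums of [h] are those of the join, so both moment conditions become polynomial
     identities in n, m, r and [alpha], involving [a] and [L] only through their sum and product. *)
  apply: (dominating_exists alpha_gt alpha_lt1 sh UU AE ak kL rootL).
    by rewrite S1 S2 aDL aML predn_natr /deg_join /kappa natrD natrM; ring.
  have -> : (alpha * (n + m)%:R - 1 - a) * (L - (alpha * (n + m)%:R - 1)) =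
      - ((alpha * (n + m)%:R - 1) ^+ 2 - (a + L) * (alpha * (n + m)%:R - 1) + a * L) by ring.
  rewrite S1 -[_ - a - L]addrA -opprD aDL aML predn_natr /deg_join /kappa natrD natrM; ring.
have := dominating_count alpha_gt alpha_lt1 sh UU AE kL rootL DE.
apply: leq_trans; rewrite -[leqLHS](prednK m_gt0) ltnS.
by move: mult; rewrite /spectrum eqC.
Qed.
End JoinSpectrum.

(** Joining shifts the degrees of G by [m] and adds [m] vertices of known degree, so the degree sums
    of the join determine those of G. *)
Lemma regular_of_gjoin_char_poly (n m r : nat) (R : rcfType) (alpha : R) (e e' : rel 'I_n) :
  alpha != 0 -> simple_graph e -> simple_graph e' -> regular r e ->
  char_poly (Aalpha alpha (gjoin e (complete m))) =
    char_poly (Aalpha alpha (gjoin e' (complete m))) ->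
  regular r e'.
Proof.
move=> alpha0 se se' er.
have sj (e0 : rel 'I_n) : simple_graph e0 -> simple_graph (gjoin e0 (complete m)).
  by move=> se0; exact: simple_gjoin se0 (simple_complete m).
move=> /(char_poly_degree_sums alpha0 (sj _ se) (sj _ se')) [S1 S2].
have sum_cst (x : R) : n%:R * x = \sum_(i < n) x by rewrite sumr_const card_ord mulr_natl.
have sumE1 (f : rel 'I_n) : \sum_i ((deg f i)%:R + m%:R) ^+ 1 =
    \sum_i (deg f i)%:R + n%:R * m%:R :> R.
  by rewrite sum_cst -big_split; apply: eq_bigr => i _ /=; ring.
have sumE2 (f : rel 'I_n) : \sum_i ((deg f i)%:R + m%:R) ^+ 2 =
    \sum_i (deg f i)%:R ^+ 2 + (2 * m%:R) * \sum_i (deg f i)%:R + n%:R * m%:R ^+ 2 :> R.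
  by rewrite mulr_sumr sum_cst -!big_split; apply: eq_bigr => i _ /=; ring.
have {}S1 : \sum_i (deg e i)%:R = \sum_i (deg e' i)%:R :> R.
  have : \sum_i (deg (gjoin e (complete m)) i)%:R ^+ 1 =
      \sum_i (deg (gjoin e' (complete m)) i)%:R ^+ 1 :> R by exact: S1.
  by rewrite !sum_deg_gjoin !sumE1 => /addIr /addIr.
have {}S2 : \sum_i (deg e i)%:R ^+ 2 = \sum_i (deg e' i)%:R ^+ 2 :> R.
  by move: S2; rewrite !sum_deg_gjoin !sumE2 S1 => /addIr /addIr /addIr.
apply: (@regular_of_degree_sums R); first by rewrite -S1 (regular_sum R 1 er).
by rewrite -S2 (regular_sum R 2 er).
Qed.

Unset Implicit Arguments.

Theorem theorem3p6 (R : rcfType) (n r m : nat) (e : rel 'I_n) (alpha : R) :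
  simple_graph e -> regular r e -> (0 < n)%N -> (r <= n.-1)%N -> (1 <= m)%N ->
  1 / 2 < alpha -> alpha < 1 ->
  determined_by_Aalpha_spectrum alpha e <->
  determined_by_Aalpha_spectrum alpha (gjoin e (complete m)).
Proof.
move=> se er n_gt0 rn m_gt0 alpha_gt alpha_lt1.
have alpha0 := alpha_neq0 alpha_gt.
have sj := simple_gjoin se (simple_complete m).
split=> [dsG p h sh /(cospectral_char_poly sj sh) [Np eqC]|dsJ p h sh].
  case: p / Np h sh eqC => h sh eqC.
  (* Thus [h] is itself a join of some [e'] with K_m; degree sums make [e'] r-regular, and
     cancelling common factors makes it cospectral to [e]. *)
  have /(split_dominating sh) [e' [se' iso]] :=
    cospectral_dominating alpha_gt alpha_lt1 n_gt0 m_gt0 se er rn sh eqC.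
  rewrite -(graph_iso_char_poly alpha iso) in eqC.
  have er' := regular_of_gjoin_char_poly alpha0 se se' er eqC.
  apply: graph_iso_trans iso; apply: graph_iso_gjoin; apply: dsG => // x.
  rewrite /spectrum.
  by have [/(_ eqC) -> _] := char_poly_gjoin_inj alpha_lt1 n_gt0 m_gt0 se se' er er'.
move=> /(cospectral_char_poly se sh) [Np eqC].
case: p / Np h sh eqC => h sh eqC.
(* With [h] also r-regular, the two joins are cospectral, hence isomorphic by [dsJ], and K_m can be
   cancelled. *)
have hr := regular_of_char_poly alpha0 se sh er eqC.
apply: (gjoin_complete_cancel se sh er hr (m := m)); apply: dsJ => [|x].
  exact: simple_gjoin sh (simple_complete m).
rewrite /spectrum.
by have [_ /(_ eqC) ->] := char_poly_gjoin_inj alpha_lt1 n_gt0 m_gt0 se sh er hr.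
Qed.
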